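(* Let $c>0$, let $\mathbb{C}\in\mathbb{R}^{N_2\times N_1}$ be the discrete curl matrix, and let $\mathbb{Q}_1\in\mathbb{R}^{N_1\times N_1}$ and $\tilde{\mathbb{M}}_2\in\mathbb{R}^{N_2\times N_2}$ be symmetric positive definite. Then $\tilde{\mathbb{K}}=c^2\,\mathbb{Q}_1\mathbb{C}^T\tilde{\mathbb{M}}_2\mathbb{C}$ has real nonnegative eigenvalues $\{\omega_j^2\}$, and, for a time step $\tau>0$, the Strang splitting map $$\Phi_\tau=\Phi^{\mathbf{e}}_{\tau/2}\circ\Phi^{\mathbf{a}}_{\tau}\circ\Phi^{\mathbf{e}}_{\tau/2}$$ on $\mathbb{R}^{2N_1}\ni(\mathbf{a},\mathbf{e})$, where $$\Phi^{\mathbf{e}}_s:(\mathbf{a},\mathbf{e})\mapsto(\mathbf{a}-s\,\mathbb{Q}_1\mathbf{e},\ \mathbf{e}),\qquad \Phi^{\mathbf{a}}_s:(\mathbf{a},\mathbf{e})\mapsto(\mathbf{a},\ \mathbf{e}+s\,c^2\,\mathbb{C}^T\tilde{\mathbb{M}}_2\mathbb{C}\,\mathbf{a}),$$ is stable if and only if $$\tau\le\frac{2}{\max_j|\omega_j|}.$$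
   Context: Discrete curl matrix: let $\boldsymbol{\Lambda}^1=(\Lambda^1_i)_{i=1}^{N_1}$ and $\boldsymbol{\Lambda}^2=(\Lambda^2_j)_{j=1}^{N_2}$ be bases of finite element spaces of differential 1-forms and 2-forms on a simplicial or cubical mesh, with the exterior derivative $d$ mapping the 1-form space into the 2-form space. The matrix $\mathbb{C}\in\mathbb{R}^{N_2\times N_1}$ is the real matrix representing $d$ in these bases, i.e. $\mathbb{C}^T\boldsymbol{\Lambda}^2=d\boldsymbol{\Lambda}^1$, so that $d(\sum_i a_i\Lambda^1_i)=\sum_j(\mathbb{C}\mathbf{a})_j\Lambda^2_j$. It is understood that $\mathbb{C}\neq0$, so that $\max_j|\omega_j|>0$. Here $c$ is the speed of light and $\mathbf{a},\mathbf{e}\in\mathbb{R}^{N_1}$. The map $\Phi_\tau$ is linear; it is called stable if all (complex) eigenvalues of its $2N_1\times 2N_1$ Jacobian matrix lie on the unit circle $\{\lambda\in\mathbb{C}:|\lambda|=1\}$ of the complex plane (in this last expression the symbol denotes the complex numbers). *)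

(* Defs.v *)
From HB Require Import structures.
From mathcomp Require Import all_boot all_order all_algebra.
From mathcomp Require Import all_classical all_reals all_analysis.
From mathcomp Require Import complex.

Set Implicit Arguments.
Unset Strict Implicit.
Unset Printing Implicit Defensive.

Import Order.TTheory GRing.Theory Num.Theory.
Import numFieldNormedType.Exports.

Local Open Scope classical_set_scope.
Local Open Scope ring_scope.

Variant cell_shape := Simplicial | Cubical.

Definition ref_cell (R : realType) n (s : cell_shape) : set 'rV[R]_n :=
  match s with
  | Simplicial => [set t | (forall i, 0 <= t 0 i) /\ \sum_i t 0 i <= 1]
  | Cubical => [set t | forall i, 0 <= t 0 i <= 1]
  end.

Definition affine_cell (R : realType) n (s : cell_shape)
    (a : 'rV[R]_n) (B : 'M[R]_n) : set 'rV[R]_n :=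
  [set a + t *m B | t in ref_cell s].

(* Faces of a convex set: extreme subsets. F is not required to be convex, as
   this is only applied to intersections of convex sets. *)
Definition is_face (R : realType) n (F K : set 'rV[R]_n) : Prop :=
  F `<=` K /\
  forall x y (t : R), K x -> K y -> 0 < t < 1 ->
    F (t *: x + (1 - t) *: y) -> F x /\ F y.

(* A mesh in R^n. Injectivity of the cells, with the face condition, makes
   their interiors pairwise disjoint. *)
Record mesh (R : realType) (n : nat) := Mesh {
  shape : cell_shape;
  ncells : nat;
  corner : 'I_ncells -> 'rV[R]_n;
  edges : 'I_ncells -> 'M[R]_n;
  cell := fun k => affine_cell shape (corner k) (edges k);
  edges_unit : forall k, edges k \in unitmx;
  cell_inj : injective cell;
  cell_face : forall k l, is_face (cell k `&` cell l) (cell k)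
}.

(* A piecewise form is given cell by cell, since it may be multivalued on the
   interfaces; the value of the k-th piece is meaningful on the k-th cell.
   A 1-covector u acts by t |-> u *m t^T, a 2-covector w (an antisymmetric
   matrix) by (s, t) |-> s *m w *m t^T. *)
Definition form1 (R : realType) n (T : mesh R n) :=
  'I_(ncells T) -> 'rV[R]_n -> 'rV[R]_n.
Definition form2 (R : realType) n (T : mesh R n) :=
  'I_(ncells T) -> 'rV[R]_n -> 'M[R]_n.

Definition tangent (R : realType) n (A : set 'rV[R]_n) (t : 'rV[R]_n) : Prop :=
  exists x y, [/\ A x, A y & t = x - y].

(* Traces on the interfaces are single-valued, which makes the cellwise
   exterior derivative the one in the sense of distributions. *)
Definition conforming1 (R : realType) n (T : mesh R n) (u : form1 T) : Prop :=
  forall k l x t, (cell k `&` cell l) x -> tangent (cell k `&` cell l) t ->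
    u k x *m t^T = u l x *m t^T.

Definition conforming2 (R : realType) n (T : mesh R n) (w : form2 T) : Prop :=
  forall k l x s t, (cell k `&` cell l) x ->
    tangent (cell k `&` cell l) s -> tangent (cell k `&` cell l) t ->
    s *m w k x *m t^T = s *m w l x *m t^T.

Definition fe_form1 (R : realType) n (T : mesh R n) (u : form1 T) : Prop :=
  [/\ forall k, {within cell k, continuous (u k)},
      forall k x, (cell k)° x -> differentiable (u k) x
    & conforming1 u].

Definition fe_form2 (R : realType) n (T : mesh R n) (w : form2 T) : Prop :=
  [/\ forall k x, cell k x -> (w k x)^T = - w k x,
      forall k, {within cell k, continuous (w k)}
    & conforming2 w].

(* Linear independence of piecewise fields, identified when they agree on the
   cells. *)
Definition lin_indep (R : realType) n (T : mesh R n) (V : lmodType R) N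
    (L : 'I_N -> 'I_(ncells T) -> 'rV[R]_n -> V) : Prop :=
  forall a : 'I_N -> R,
    (forall k x, cell k x -> \sum_i a i *: L i k x = 0) -> forall i, a i = 0.

(* A basis of a finite element space, the latter being its span. *)
Definition fe_basis1 (R : realType) n (T : mesh R n) N (L : 'I_N -> form1 T) :=
  (forall i, fe_form1 (L i)) /\ lin_indep L.
Definition fe_basis2 (R : realType) n (T : mesh R n) N (L : 'I_N -> form2 T) :=
  (forall j, fe_form2 (L j)) /\ lin_indep L.

(* du(s, t) = D_s u (t) - D_t u (s). *)
Definition ext_deriv (R : realType) n (u : 'rV[R]_n -> 'rV[R]_n)
    (x : 'rV[R]_n) : 'M[R]_n :=
  \matrix_(i, j) ('D_(delta_mx 0 i) (fun y => u y 0 j) x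
                - 'D_(delta_mx 0 j) (fun y => u y 0 i) x).

(* C^T L2 = d L1; in particular d maps the span of L1 into the span of L2. *)
Definition discrete_curl (R : realType) n (T : mesh R n) N1 N2
    (L1 : 'I_N1 -> form1 T) (L2 : 'I_N2 -> form2 T) (C : 'M[R]_(N2, N1)) :=
  forall i k x, (cell k)° x ->
    ext_deriv (L1 i k) x = \sum_j C^T i j *: L2 j k x.

Definition spd (R : realType) n (A : 'M[R]_n) : Prop :=
  A^T = A /\ forall x : 'cV[R]_n, x != 0 -> 0 < (x^T *m A *m x) 0 0.

Definition Cmx (R : realType) n (A : 'M[R]_n) : 'M[R[i]]_n :=
  map_mx (real_complex R) A.

(* The complex eigenvalues of A are exactly the (real) numbers (w j)^2. *)
Definition eigenvalues_sq (R : realType) n (A : 'M[R]_n) (w : 'I_n -> R) :=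
  forall z : R[i], eigenvalue (Cmx A) z <-> exists j, z = real_complex R (w j ^+ 2).

(* The phase space R^(2 N1) is 'cV_(N1 + N1), with (a, e) = col_mx a e. *)
Definition flow_e (R : realType) N1 (Q : 'M[R]_N1) (s : R)
    (z : 'cV[R]_(N1 + N1)) : 'cV[R]_(N1 + N1) :=
  col_mx (usubmx z - s *: (Q *m dsubmx z)) (dsubmx z).

Definition flow_a (R : realType) N1 N2 (c : R) (C : 'M[R]_(N2, N1))
    (M2 : 'M[R]_N2) (s : R) (z : 'cV[R]_(N1 + N1)) : 'cV[R]_(N1 + N1) :=
  col_mx (usubmx z) (dsubmx z + (s * c ^+ 2) *: (C^T *m M2 *m C *m usubmx z)).

Definition strang (R : realType) N1 N2 (c : R) (C : 'M[R]_(N2, N1))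
    (Q : 'M[R]_N1) (M2 : 'M[R]_N2) (tau : R) :
    'cV[R]_(N1 + N1) -> 'cV[R]_(N1 + N1) :=
  flow_e Q (tau / 2) \o flow_a c C M2 tau \o flow_e Q (tau / 2).

Definition jacobian_mx (R : realType) m (f : 'cV[R]_m -> 'cV[R]_m)
    (z : 'cV[R]_m) : 'M[R]_m :=
  \matrix_(i, j) 'D_(delta_mx j 0) (fun y => f y i 0) z.

(* Intended for linear f, whose Jacobian matrix does not depend on z. *)
Definition stable (R : realType) m (f : 'cV[R]_m -> 'cV[R]_m) : Prop :=
  forall z (l : R[i]), eigenvalue (Cmx (jacobian_mx f z)) l -> `|l| = 1.

(* Main.v *)
Require Import Defs.
From HB Require Import structures.
From mathcomp Require Import all_boot all_order all_algebra.
From mathcomp Require Import all_classical all_reals all_analysis.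
From mathcomp Require Import complex.
From mathcomp Require Import ring lra.

(* Put S = c^2 C^T M2 C and K = Q1 S.  If v K = z v, then comparing the real and
   imaginary parts of v through the forms of Q1 and S gives
   |v Q1|_S^2 = z |v|_Q1^2, so z is real and nonnegative; K is self-adjoint for
   Q1 and nonzero, hence not nilpotent, so some eigenvalue is nonzero.
   For the splitting map with matrix J, eliminating y from
   (x, y) J = l (x, y) yields (l - 1)^2 x = - tau^2 l (x K).  Hence l = 1, or
   (l - 1)^2 = - tau^2 w^2 l for some eigenvalue w^2 of K.  The two roots of
   this quadratic have product 1 and sum 2 - tau^2 w^2: they lie on the unit
   circle if tau^2 w^2 <= 4; otherwise they are real and one is less than -1. *)

Set Implicit Arguments.
Unset Strict Implicit.
Unset Printing Implicit Defensive.

Import Order.TTheory GRing.Theory Num.Theory.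
Import numFieldNormedType.Exports.

Local Open Scope ring_scope.

(** * Bilinear forms of symmetric matrices *)

Section BilinearForm.
Variables (R : comNzRingType) (n : nat).
Implicit Types (A : 'M[R]_n) (u v : 'rV[R]_n).

(** Set on rows, unlike [spd], because [eigenvalue] refers to row vectors [v] with
    [v *m A = z *: v]. *)
Definition bform A u v : R := (u *m A *m v^T) 0 0.

Lemma bformDl A u u' v : bform A (u + u') v = bform A u v + bform A u' v.
Proof. by rewrite /bform !mulmxDl mxE. Qed.

Lemma bformZl A a u v : bform A (a *: u) v = a * bform A u v.
Proof. by rewrite /bform -!scalemxAl mxE. Qed.

Lemma bformC A u v : A^T = A -> bform A u v = bform A v u.
Proof.
move=> sA; rewrite /bform -[in LHS](trmxK (u *m A *m v^T)) [LHS]mxE.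
by rewrite !trmx_mul trmxK sA mulmxA.
Qed.

Lemma bform_mulmx A S u v : A^T = A ->
  bform S (u *m A) (v *m A) = bform A (u *m (A *m S)) v.
Proof. by move=> sA; rewrite /bform trmx_mul sA !mulmxA. Qed.

End BilinearForm.

(** Definiteness would be too much to ask of [c ^+ 2 *: (C^T *m M2 *m C)], since [C] may have a
    kernel. *)
Definition psd (R : realType) n (A : 'M[R]_n) : Prop :=
  A^T = A /\ forall v, 0 <= bform A v v.

Lemma spd_bform_gt0 (R : realType) n (A : 'M[R]_n) v :
  spd A -> v != 0 -> 0 < bform A v v.
Proof.
case=> _ pA v0; have := pA v^T; rewrite trmxK; apply.
by rewrite -(inj_eq (@trmx_inj _ _ _)) trmxK trmx0.
Qed.

Lemma spd_bform_ge0 (R : realType) n (A : 'M[R]_n) v :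
  spd A -> 0 <= bform A v v.
Proof.
move=> pA; have [->|v0] := eqVneq v 0; last exact/ltW/spd_bform_gt0.
by rewrite /bform !mul0mx mxE.
Qed.

Lemma spd_bform_eq0 (R : realType) n (A : 'M[R]_n) v :
  spd A -> bform A v v = 0 -> v = 0.
Proof.
by move=> pA; apply: contra_eq => v0; rewrite gt_eqF// spd_bform_gt0.
Qed.

(** * Reality and sign of the spectrum *)

Lemma map_Re_mulmx (R : realType) m n (v : 'rV[R[i]]_m) (A : 'M[R]_(m, n)) :
  map_mx (@complex.Re R) (v *m map_mx (real_complex R) A) =
  map_mx (@complex.Re R) v *m A.
Proof.
apply/matrixP=> i j; rewrite !mxE raddf_sum; apply: eq_bigr => k _.
by rewrite !mxE; case: (v i k) => a b /=; rewrite mulr0 subr0.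
Qed.

Lemma map_Im_mulmx (R : realType) m n (v : 'rV[R[i]]_m) (A : 'M[R]_(m, n)) :
  map_mx (@complex.Im R) (v *m map_mx (real_complex R) A) =
  map_mx (@complex.Im R) v *m A.
Proof.
apply/matrixP=> i j; rewrite !mxE raddf_sum; apply: eq_bigr => k _.
by rewrite !mxE; case: (v i k) => a b /=; rewrite mulr0 add0r.
Qed.

Lemma eigenvalue_spd_psd (R : realType) n (Q S : 'M[R]_n) (z : R[i]) :
  spd Q -> psd S -> eigenvalue (Cmx (Q *m S)) z ->
  exists2 r : R, 0 <= r & z = real_complex R r.
Proof.
move=> pQ [sS pS] /eigenvalueP[v vK v0].
case: z vK => p q vK.
set a := map_mx (@complex.Re R) v; set b := map_mx (@complex.Im R) v.
have aK : a *m (Q *m S) = p *: a + (- q) *: b.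
  rewrite -map_Re_mulmx vK; apply/matrixP => i j; rewrite !mxE.
  by case: (v i j) => x y /=; rewrite mulNr.
have bK : b *m (Q *m S) = q *: a + p *: b.
  rewrite -map_Im_mulmx vK; apply/matrixP => i j; rewrite !mxE.
  by case: (v i j) => x y /=; rewrite addrC.
have sQ : Q^T = Q by case: pQ.
have ab_gt0 : 0 < bform Q a a + bform Q b b.
  rewrite lt_def addr_ge0 ?spd_bform_ge0// andbT.
  apply: contra v0; rewrite paddr_eq0 ?spd_bform_ge0//.
  move=> /andP[/eqP a0 /eqP b0].
  have /rowP va := spd_bform_eq0 pQ a0; have /rowP vb := spd_bform_eq0 pQ b0.
  apply/eqP/rowP => j; move: (va j) (vb j).
  by rewrite !mxE; case: (v 0 j) => x y /= -> ->.
have Eaa : bform S (a *m Q) (a *m Q) = p * bform Q a a - q * bform Q a b.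
  by rewrite bform_mulmx// aK bformDl !bformZl mulNr (bformC b).
have Ebb : bform S (b *m Q) (b *m Q) = q * bform Q a b + p * bform Q b b.
  by rewrite bform_mulmx// bK bformDl !bformZl.
have Eab : bform S (a *m Q) (b *m Q) = p * bform Q a b - q * bform Q b b.
  by rewrite bform_mulmx// aK bformDl !bformZl mulNr.
have Eba : bform S (b *m Q) (a *m Q) = q * bform Q a a + p * bform Q a b.
  by rewrite bform_mulmx// bK bformDl !bformZl (bformC b).
(* Symmetry of [S] equates the mixed values [Eab] and [Eba]. *)
have /eqP : q * (bform Q a a + bform Q b b) = 0.
  by have := bformC (a *m Q) (b *m Q) sS; rewrite Eab Eba; lra.
rewrite mulf_eq0 (gt_eqF ab_gt0) orbF => /eqP q0.
exists p; last by rewrite q0.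
(* In the sum of [Eaa] and [Ebb] the cross terms cancel, leaving [p] times the positive quantity of
   [ab_gt0]. *)
rewrite -(pmulr_lge0 _ ab_gt0).
by have := addr_ge0 (pS (a *m Q)) (pS (b *m Q)); rewrite Eaa Ebb; lra.
Qed.

(** * Nilpotency and enumeration of eigenvalues *)

(** The exponent is lowered one at a time: [L] = [K ^+ m.+1] is self-adjoint for [Q], so the square
    norm of [v *m L] is the form of [v *m L *m L] against [v], and [L ^+ 2] contains the factor
    [K ^+ m.+2] = 0. *)
Lemma selfadjoint_nilpotent_eq0 (R : realType) n (Q K : 'M[R]_n.+1) m :
  spd Q -> K *m Q = Q *m K^T -> K ^+ m.+1 = 0 -> K = 0.
Proof.
move=> pQ sK; elim: m => [|m IH]; first by rewrite expr1.
move=> K0; apply: IH; set L := K ^+ m.+1.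
have sL k : K ^+ k *m Q = Q *m (K ^+ k)^T.
  elim: k => [|k IHk]; first by rewrite !expr0 trmx1 mulmx1 mul1mx.
  rewrite exprS -mulmxE -mulmxA IHk !mulmxA sK -mulmxA -trmx_mul mulmxE.
  by rewrite -exprSr -exprS.
apply/row_matrixP => i; rewrite row0 rowE; apply: (spd_bform_eq0 pQ).
rewrite /bform trmx_mul -!mulmxA [Q *m _]mulmxA -sL !mulmxA.
rewrite -[_ *m L *m L]mulmxA mulmxE -exprD addnS -addSn exprD K0.
by rewrite mul0r mulmx0 !mul0mx mxE.
Qed.

(** The characteristic polynomial is a power of ['X], so Cayley-Hamilton applies. *)
Lemma nilpotent_of_eigenvalues (F : closedFieldType) n (A : 'M[F]_n.+1) :
  (forall z, eigenvalue A z -> z = 0) -> A ^+ n.+1 = 0.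
Proof.
move=> A0; have [r] := closed_field_poly_normal (char_poly A).
rewrite (monicP (char_poly_monic A)) scale1r => Er.
have r0 z : z \in r -> z = 0.
  by move=> zr; apply: A0; rewrite eigenvalue_root_char Er root_prod_XsubC.
have {}Er : char_poly A = 'X^(size r).
  rewrite Er big_seq (eq_bigr (fun=> 'X)) -?big_seq ?prodr_const_seq//.
    by rewrite big_const_seq count_predT iter_mulr_1.
  by move=> z /r0->; rewrite subr0.
have sr : size r = n.+1.
  by have := size_char_poly A; rewrite Er size_polyXn => -[].
by have := Cayley_Hamilton A; rewrite Er sr rmorphXn/= horner_mx_X.
Qed.

(** [s] lists the roots of the characteristic polynomial with multiplicity; its degree is [n]. *)
Lemma exists_eigenvalues (F : closedFieldType) n (A : 'M[F]_n) :
  exists s : 'I_n -> F, forall z, eigenvalue A z <-> exists j, z = s j.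
Proof.
have [r] := closed_field_poly_normal (char_poly A).
rewrite (monicP (char_poly_monic A)) scale1r => Er.
have sr : size r = n.
  by have := size_char_poly A; rewrite Er size_prod_XsubC => -[].
exists (fun j => r`_j) => z; rewrite eigenvalue_root_char Er root_prod_XsubC.
split=> [zr|[j ->]]; last by rewrite mem_nth// sr.
have ltin : (index z r < n)%N by rewrite -sr index_mem.
by exists (Ordinal ltin); rewrite nth_index.
Qed.

(** * The matrix of the splitting map and its eigenvalues *)

Section StrangMatrix.
Variables (F : fieldType) (n : nat).
Implicit Types (Q S : 'M[F]_n).

(** The matrix of [flow_e] on columns; a general field serves both the reals and their
    complexification. *)
Definition kick_e_mx Q (s : F) : 'M[F]_(n + n) :=
  block_mx 1%:M (- s *: Q) 0 1%:M.

Definition kick_a_mx S (s : F) : 'M[F]_(n + n) :=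
  block_mx 1%:M 0 (s *: S) 1%:M.

Definition strang_mx Q S (t : F) : 'M[F]_(n + n) :=
  kick_e_mx Q (t / 2) *m kick_a_mx S t *m kick_e_mx Q (t / 2).

Lemma mul_row_strang_mx Q S t (x y : 'rV_n) :
  let y1 := y - (t / 2) *: (x *m Q) in
  let x1 := x + t *: (y1 *m S) in
  row_mx x y *m strang_mx Q S t = row_mx x1 (y1 - (t / 2) *: (x1 *m Q)).
Proof.
move=> y1 x1; rewrite /strang_mx !mulmxA /kick_e_mx /kick_a_mx !mul_row_block.
rewrite !mulmx1 !mulmx0 !addr0 !add0r -!scalemxAr !scaleNr ![- _ + _]addrC.
by rewrite -/y1 -/x1.
Qed.

Lemma eigenvalue_strang_mx Q S t l : t != 0 -> (2 : F) != 0 ->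
  eigenvalue (strang_mx Q S t) l ->
  l = 1 \/ exists2 k, eigenvalue (Q *m S) k & (l - 1) ^+ 2 = - (t ^+ 2 * k * l).
Proof.
move=> t0 n2 /eigenvalueP[v]; rewrite -[v]hsubmxK.
move: (lsubmx v) (rsubmx v) => x y.
rewrite mul_row_strang_mx scale_row_mx => /eq_row_mx[].
set y1 := y - _ => Ex; rewrite Ex -scalemxAl => Ey v0.
(* If [x] = 0, both half steps fix [y], which forces [l] = 1. *)
have [x0|x0] := eqVneq x 0.
  left; apply/eqP; rewrite -subr_eq0.
  have y0 : y != 0 by apply: contra v0 => /eqP->; rewrite x0 row_mx0.
  move/eqP: Ey; rewrite /y1 x0 mul0mx !scaler0 !subr0 -subr_eq0.
  rewrite -{1}[y]scale1r -scalerBl scaler_eq0 (negPf y0) orbF.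
  by rewrite !subr_eq0 eq_sym.
right.
(* Writing [y] as [y1 + (t / 2) *: (x *m Q)] in [Ey] merges the two half steps into a full one. *)
have Ey1 : (l - 1) *: y1 = - (t * l) *: (x *m Q).
  move: Ey; rewrite /y1; move: (x *m Q) => a Ey; apply/rowP => j.
  have /rowP/(_ j) := Ey; rewrite !mxE => {}Ey.
  apply/eqP; rewrite -subr_eq0 -oppr_eq0; apply/eqP.
  by transitivity (y 0 j - t / 2 * a 0 j - t / 2 * (l * a 0 j) - l * y 0 j);
    [field | rewrite Ey subrr].
have Exx : (l - 1) ^+ 2 *: x = - (t ^+ 2 * l) *: (x *m (Q *m S)).
  have -> : (l - 1) ^+ 2 *: x = t *: (((l - 1) *: y1) *m S).
    have lx : (l - 1) *: x = t *: (y1 *m S).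
      by rewrite scalerBl scale1r -Ex addrAC subrr add0r.
    by rewrite expr2 -scalerA lx -scalemxAl !scalerA mulrC.
  by rewrite Ey1 -scalemxAl mulmxA scalerA; congr (_ *: _); ring.
have l0 : l != 0.
  apply: contra_eq_neq Exx => ->.
  by rewrite mulr0 oppr0 scale0r sub0r sqrrN expr1n scale1r.
exists (- (l - 1) ^+ 2 / (t ^+ 2 * l)); last by field; rewrite l0.
apply/eigenvalueP; exists x => //; rewrite mulrC -scalerA scaleNr Exx.
rewrite -scaleNr scalerA -[LHS]scale1r; congr (_ *: _); field; exact/andP.
Qed.

Lemma eigenvalue_strang_mx_of Q S t l k : (2 : F) != 0 -> l != 1 ->
  eigenvalue (Q *m S) k -> (l - 1) ^+ 2 = - (t ^+ 2 * k * l) ->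
  eigenvalue (strang_mx Q S t) l.
Proof.
move=> n2 l1 /eigenvalueP[x xK x0] El.
have l10 : l - 1 != 0 by rewrite subr_eq0.
apply/eigenvalueP.
(* The second block is forced: [y1] must be [- (t * l / (l - 1)) *: (x *m Q)], and [y] is
   [y1 + (t / 2) *: (x *m Q)]. *)
exists (row_mx x (- (t / 2 * (l + 1) / (l - 1)) *: (x *m Q))); last first.
  by apply: contra_neq x0; rewrite -row_mx0 => /eq_row_mx[].
rewrite mul_row_strang_mx scale_row_mx.
have -> : - (t / 2 * (l + 1) / (l - 1)) *: (x *m Q) - (t / 2) *: (x *m Q)
        = - (t * l / (l - 1)) *: (x *m Q).
  by rewrite -scalerBl; congr (_ *: _); field; rewrite ?n2 ?l10.
have -> : x + t *: (- (t * l / (l - 1)) *: (x *m Q) *m S) = l *: x.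
  rewrite -scalemxAl -mulmxA xK !scalerA -[X in X + _]scale1r -scalerDl.
  congr (_ *: _); apply: (mulIf l10); rewrite mulrDl mul1r.
  transitivity (l - 1 - t ^+ 2 * k * l); first by field; rewrite ?l10.
  by rewrite -El; ring.
congr row_mx; rewrite -scalemxAl !scalerA -scalerBl; congr (_ *: _).
by field; rewrite ?n2 ?l10.
Qed.

End StrangMatrix.

Lemma map_strang_mx (R : realType) n (Q S : 'M[R]_n) (t : R) :
  Cmx (strang_mx Q S t) = strang_mx (Cmx Q) (Cmx S) (real_complex R t).
Proof.
rewrite /Cmx /strang_mx /kick_e_mx /kick_a_mx !map_mxM !map_block_mx.
by rewrite !map_mx1 !map_mx0 !map_mxZ rmorphN/= !fmorph_div/= rmorph_nat.
Qed.

Lemma strangE (R : realType) N1 N2 (c : R) (C : 'M[R]_(N2, N1)) Q M2 tau :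
  strang c C Q M2 tau =
  fun z => strang_mx Q (c ^+ 2 *: (C^T *m M2 *m C)) tau *m z.
Proof.
have flow_eE s z : flow_e Q s z = kick_e_mx Q s *m z.
  rewrite -[z in RHS]vsubmxK mul_block_col !mul1mx mul0mx add0r.
  by rewrite -scalemxAl scaleNr.
have flow_aE s z :
    flow_a c C M2 s z = kick_a_mx (c ^+ 2 *: (C^T *m M2 *m C)) s *m z.
  rewrite -[z in RHS]vsubmxK mul_block_col !mul1mx mul0mx addr0.
  by rewrite scalerA -scalemxAl addrC.
by apply/funext => z; rewrite /strang/= !flow_eE flow_aE !mulmxA.
Qed.

Lemma jacobian_mx_mulmx (R : realType) m (A : 'M[R]_m) z :
  jacobian_mx (fun y => A *m y) z = A.
Proof.
apply/matrixP => i j; rewrite mxE /derive.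
(* The difference quotient of a linear map is constant for nonzero [h]. *)
apply: lim_near_cst => //; near=> h.
rewrite /= mulmxDr mxE addrK -scalemxAr mxE -colE mxE.
rewrite /GRing.scale/= mulKf//.
by near: h; exact: nbhs_dnbhs_neq.
Unshelve. all: by end_near. Qed.

(** * The quadratic equation and the stability threshold *)

Lemma strang_quadratic_unit_circle (R : realType) (m : R) (l : R[i]) :
  0 <= m <= 4 -> (l - 1) ^+ 2 = - (real_complex R m * l) -> `|l| = 1.
Proof.
case: l => a b /andP[m0 m4] /eqP; rewrite eq_complex /=.
move=> /andP[/eqP Er /eqP Ei].
suff ab1 : a ^+ 2 + b ^+ 2 = 1 by rewrite normc_def /= ab1 sqrtr1.
have [b0|b0] := eqVneq b 0.
  (* Completing the square: for a real root both nonnegative terms vanish, leaving the double roots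
     1 ([m] = 0) and -1 ([m] = 4). *)
  have {}Er : (a - (2 - m) / 2) ^+ 2 + m * (4 - m) / 4 = 0.
    by move: Er; rewrite b0; lra.
  have : 0 <= m * (4 - m) by rewrite mulr_ge0// subr_ge0.
  move=> mm; have /eqP am : (a - (2 - m) / 2) ^+ 2 == 0.
    by rewrite eq_le sqr_ge0 andbT; lra.
  have {}am : a = (2 - m) / 2.
    by apply/eqP; rewrite -subr_eq0 -sqrf_eq0; apply/eqP.
  by move: Er; rewrite b0 am; lra.
(* For a nonreal root the imaginary part gives the sum of the conjugate roots; the real part then
   gives their product 1. *)
have am : 2 * a = 2 - m.
  by apply: (mulIf b0); move: Ei; lra.
have : m = 2 - 2 * a by lra.
by move: Er => /[swap] ->; lra.
Qed.

Lemma strang_quadratic_unstable (R : realType) (m : R) :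
  4 < m -> exists2 l : R, l < -1 & (l - 1) ^+ 2 = - (m * l).
Proof.
move=> m4; pose d := m * (m - 4); pose s := Num.sqrt d.
have d0 : 0 < d by rewrite mulr_gt0 ?subr_gt0// (lt_trans _ m4).
have ss : s ^+ 2 = d by rewrite sqr_sqrtr// ltW.
have s0 : 0 < s by rewrite sqrtr_gt0.
(* The smaller real root; [d] is the discriminant [(2 - m) ^+ 2 - 4]. *)
exists ((2 - m - s) / 2); first by lra.
transitivity ((m ^+ 2 + 2 * m * s + s ^+ 2) / 4); first by field.
by rewrite ss /d; field.
Qed.

Lemma strang_stableP (R : realType) N1 N2 (c : R) (C : 'M[R]_(N2, N1))
    Q M2 tau :
  let S := c ^+ 2 *: (C^T *m M2 *m C) in
  spd Q -> psd S -> 0 < tau ->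
  stable (strang c C Q M2 tau) <->
  forall r : R, eigenvalue (Cmx (Q *m S)) (real_complex R r) ->
    tau ^+ 2 * r <= 4.
Proof.
move=> S pQ pS tau0.
have n2 : (2 : R[i]) != 0 by rewrite pnatr_eq0.
have tC0 : real_complex R tau != 0.
  by rewrite (inj_eq (@complexI R)) ?gt_eqF.
have CQS : Cmx (Q *m S) = Cmx Q *m Cmx S by rewrite /Cmx map_mxM.
rewrite strangE -/S CQS; split=> [st r rK|bd z l].
  rewrite leNgt; apply/negP => /strang_quadratic_unstable[l l1 El].
  have l_neq1 : real_complex R l != 1.
    by rewrite -(rmorph1 (real_complex R)) (inj_eq (@complexI R)) lt_eqF//; lra.
  have : `|real_complex R l| = 1.
    (* Any base point would do, the Jacobian being constant. *)
    apply: (st 0); rewrite jacobian_mx_mulmx map_strang_mx.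
    apply: (eigenvalue_strang_mx_of n2 l_neq1 rK).
    rewrite -(rmorph1 (real_complex R)) -rmorphB.
    by rewrite -!rmorphXn -!rmorphM El rmorphN.
  rewrite normc_def /= expr0n addr0 sqrtr_sqr => -[].
  by rewrite ltr0_norm; lra.
rewrite jacobian_mx_mulmx map_strang_mx.
move=> /(eigenvalue_strang_mx tC0 n2)[->|[k kK El]]; first exact: normr1.
have [r r0 kr] : exists2 r : R, 0 <= r & k = real_complex R r.
  by apply: (eigenvalue_spd_psd pQ pS); rewrite CQS.
rewrite kr in kK El; apply: (@strang_quadratic_unit_circle _ (tau ^+ 2 * r)).
  by rewrite mulr_ge0 ?sqr_ge0//= bd.
by rewrite El rmorphM rmorphXn.
Qed.

(** * Semidefiniteness and nonzero spectrum of the curl-curl matrix *)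

Lemma bform_congruence (R : realType) N1 N2 (c : R) (C : 'M[R]_(N2, N1)) M2 v :
  bform (c ^+ 2 *: (C^T *m M2 *m C)) v v =
  c ^+ 2 * bform M2 (v *m C^T) (v *m C^T).
Proof.
by rewrite /bform -scalemxAr -scalemxAl mxE trmx_mul trmxK !mulmxA.
Qed.

Lemma psd_congruence (R : realType) N1 N2 (c : R) (C : 'M[R]_(N2, N1)) M2 :
  spd M2 -> psd (c ^+ 2 *: (C^T *m M2 *m C)).
Proof.
move=> pM; have [sM _] := pM; split=> [|v].
  by rewrite linearZ/= !trmx_mul trmxK sM mulmxA.
by rewrite bform_congruence mulr_ge0 ?sqr_ge0 ?spd_bform_ge0.
Qed.

(** If the product vanished, each row of [C^T] would have zero norm for [M2]. *)
Lemma congruence_neq0 (R : realType) N1 N2 (c : R) (C : 'M[R]_(N2, N1)) M2 :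
  spd M2 -> c != 0 -> C != 0 -> c ^+ 2 *: (C^T *m M2 *m C) != 0.
Proof.
move=> pM c0; apply: contra_neq => S0; apply/trmx_inj/row_matrixP => i.
rewrite rowE trmx0 row0; apply: (spd_bform_eq0 pM).
apply: (mulfI (expf_neq0 2 c0)); rewrite -bform_congruence S0.
by rewrite /bform mulmx0 mul0mx mxE mulr0.
Qed.

(** If [Q *m S] vanished, each row of [S] would have zero norm for [Q]. *)
Lemma spd_mulmx_neq0 (R : realType) n (Q S : 'M[R]_n) :
  spd Q -> S^T = S -> S != 0 -> Q *m S != 0.
Proof.
move=> pQ sS; apply: contra_neq => QS0; apply/row_matrixP => i.
rewrite row0 rowE; apply: (spd_bform_eq0 pQ).
by rewrite /bform trmx_mul sS -!mulmxA [Q *m _]mulmxA QS0 mul0mx !mulmx0 mxE.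
Qed.

(* Otherwise the matrix, self-adjoint for the form of [Q], is nilpotent. *)
Lemma spd_psd_nonzero_eigenvalue (R : realType) n (Q S : 'M[R]_n) :
  spd Q -> S^T = S -> S != 0 ->
  exists2 z, eigenvalue (Cmx (Q *m S)) z & z != 0.
Proof.
move=> pQ sS S0; have QS0 := spd_mulmx_neq0 pQ sS S0.
apply/not_exists2P => ev0.
case: n => [|n] in Q S pQ sS S0 QS0 ev0 *.
  by rewrite [S]flatmx0 eqxx in S0.
have : Cmx (Q *m S) ^+ n.+1 = 0.
  apply: nilpotent_of_eigenvalues => z zK.
  by have [|/negP/negPn/eqP] := ev0 z.
rewrite /Cmx -rmorphXn => /eqP; rewrite map_mx_eq0 => /eqP QSn.
move/eqP: QS0; apply; apply: (selfadjoint_nilpotent_eq0 pQ _ QSn).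
by have [sQ _] := pQ; rewrite trmx_mul sQ sS mulmxA.
Qed.

Theorem proposition3p2 (R : realType) (n N1 N2 : nat) (T : mesh R n)
    (L1 : 'I_N1 -> form1 T) (L2 : 'I_N2 -> form2 T)
    (hL1 : fe_basis1 L1) (hL2 : fe_basis2 L2)
    (C : 'M[R]_(N2, N1)) (hC : discrete_curl L1 L2 C) (C_neq0 : C != 0)
    (c : R) (c_gt0 : 0 < c)
    (Q1 : 'M[R]_N1) (hQ1 : spd Q1) (M2 : 'M[R]_N2) (hM2 : spd M2) :
  let K : 'M[R]_N1 := c ^+ 2 *: (Q1 *m C^T *m M2 *m C) in
  (exists w : 'I_N1 -> R, eigenvalues_sq K w) /\
  (forall (w : 'I_N1 -> R), eigenvalues_sq K w ->
   forall tau : R, 0 < tau ->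
     (stable (strang c C Q1 M2 tau) <->
      tau <= 2 / \big[Num.max/0]_(j < N1) `|w j|)).
Proof.
have pS := psd_congruence c C hM2; set S := c ^+ 2 *: _ in pS => K.
have KE : K = Q1 *m S by rewrite /K /S -scalemxAr !mulmxA.
have Kr z : eigenvalue (Cmx K) z -> exists2 r, 0 <= r & z = real_complex R r.
  by rewrite KE; exact: eigenvalue_spd_psd.
split.
  have [s sE] := exists_eigenvalues (Cmx K).
  have sr j : exists2 r, 0 <= r & s j = real_complex R r.
    by apply: Kr; apply/sE; exists j.
  exists (fun j => Num.sqrt (complex.Re (s j))) => z; rewrite sE.
  have sqE j : real_complex R (Num.sqrt (complex.Re (s j)) ^+ 2) = s j.
    by have [r r0 ->] := sr j; rewrite sqr_sqrtr.
  by split=> -[j ->]; exists j; rewrite sqE.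
move=> w wE tau tau0; set m := \big[_/_]_(_ < _) _.
have wm j : `|w j| <= m by exact: (le_bigmax _ (fun j => `|w j|)).
(* Needed because [2 / 0] is 0 here, which would make the bound on [tau] fail. *)
have m0 : 0 < m.
  have S0 := congruence_neq0 hM2 (lt0r_neq0 c_gt0) C_neq0.
  have [z] := spd_psd_nonzero_eigenvalue hQ1 pS.1 S0.
  rewrite -/S -KE => /wE[j ->] wj0; apply: lt_le_trans (wm j).
  by rewrite normr_gt0; apply: contra_neq wj0 => ->; rewrite expr0n.
have bd j : (tau ^+ 2 * w j ^+ 2 <= 4) = (tau * `|w j| <= 2).
  rewrite -[w j ^+ 2]real_normK ?num_real// -exprMn.
  rewrite (_ : 4 = 2 ^+ 2 :> R); last by ring.
  by rewrite ler_pXn2r// nnegrE// mulr_ge0// ltW.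
apply: (iff_trans (strang_stableP hQ1 pS tau0)).
rewrite -/S -KE ler_pdivlMr//; split=> [st|le2 r].
  (* Bounding the maximum by [2 / tau] means bounding its default value 0 and each [w j] in absolute
     value. *)
  rewrite mulrC -ler_pdivlMr//; apply/bigmax_leP; split=> [|j _].
    by rewrite divr_ge0// ltW.
  by rewrite ler_pdivlMr// mulrC -bd; apply/st/wE; exists j.
move=> /wE[j /complexI->]; rewrite bd; apply: le_trans le2.
by rewrite ler_pM2l.
Qed.
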